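(* Let $E \subseteq Vect(\mathbb{R}^2)$ be the locally free involutive $C^\infty(\mathbb{R}^2)$-submodule generated by $v_1 = x\frac{\partial}{\partial x} + y\frac{\partial}{\partial y}$ and $v_2 = -y\frac{\partial}{\partial x} + x\frac{\partial}{\partial y}$, and let $\Pi_E = v_1 \wedge v_2 = (x^2+y^2)\frac{\partial}{\partial x}\wedge\frac{\partial}{\partial y}$ be the associated Poisson structure on $\mathbb{R}^2$. Then the $E$-cohomology ${^E}H^*(\mathbb{R}^2)$ is not isomorphic (as a graded real vector space) to the Poisson cohomology $H^*_{\Pi_E}(\mathbb{R}^2)$.
   Context: $Vect(M)$ is the $C^\infty(M)$-module of smooth vector fields on $M$. A locally free involutive submodule $E \subseteq Vect(M)$ determines a vector bundle ${^E}TM$ whose sections are the sections of $E$, with dual ${^E}T^*M$. $E$-forms of degree $p$ are the global sections of $\wedge^p({^E}T^*M)$; they form ${^E}\Omega^p(M)$. The differential is $$d\omega(V_0,\dots,V_p) = \sum_i (-1)^i V_i(\omega(V_0,\dots,\hat V_i,\dots,V_p)) + \sum_{i<j}(-1)^{i+j}\omega([V_i,V_j],V_0,\dots,\hat V_i,\dots,\hat V_j,\dots,V_p),$$ and ${^E}H^*(M)$ is the cohomology of the complex $({^E}\Omega^*(M), d)$. The Poisson cohomology $H^*_\Pi(M)$ of a Poisson manifold $(M,\Pi)$ is the cohomology of the complex of smooth multivector fields on $M$ with differential $[\Pi,\cdot]$ (Schouten bracket). *)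

(* Defs.v *)
From HB Require Import structures.
From mathcomp Require Import all_boot all_order all_algebra.
From mathcomp Require Import all_classical all_reals all_analysis.
From mathcomp Require Import ring.

Set Implicit Arguments.
Unset Strict Implicit.
Unset Printing Implicit Defensive.

Import Order.TTheory GRing.Theory Num.Theory.
Import numFieldNormedType.Exports.
Local Open Scope ring_scope.

Section QuotientSpace.
Variables (R : realType) (V : lmodType R) (U : submodClosed V).

Definition asZmodClosed : {pred V} := [pred v | v \in U].
Lemma asZmodClosed_subproof : zmod_closed asZmodClosed.
Proof.
split=> [|v w Uv Uw]; first exact: (rpred0 U).
by rewrite -scaleN1r; apply: (rpredD Uv); apply: rpredZ.
Qed.
HB.instance Definition _ :=
  GRing.isZmodClosed.Build V asZmodClosed asZmodClosed_subproof.

Definition quotient : Type := @Quotient.quot V asZmodClosed.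
HB.instance Definition _ := GRing.Zmodule.on quotient.
HB.instance Definition _ : EqQuotient V (@Quotient.equiv V asZmodClosed) quotient :=
  EqQuotient.on quotient.

Definition qproj (v : V) : quotient := \pi_(quotient)%qT v.

Lemma qproj_eq (v w : V) : (qproj v == qproj w) = (v - w \in U).
Proof. by rewrite /qproj [RHS](@Quotient.idealrBE V asZmodClosed). Qed.

Lemma qprojP (a : quotient) : exists v, a = qproj v.
Proof. by exists (repr a); rewrite /qproj reprK. Qed.

Lemma qprojD : {morph qproj : v w / v + w}.
Proof. by move=> v w; rewrite /qproj; rewrite [LHS](@Quotient.pi_add V asZmodClosed). Qed.

Definition qscale (a : R) (x : quotient) : quotient := qproj (a *: repr x).

Lemma qscaleE a v : qscale a (qproj v) = qproj (a *: v).
Proof.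
apply/eqP; rewrite qproj_eq -scalerBr rpredZ // -qproj_eq.
by rewrite /qproj reprK.
Qed.

Lemma qscaleA a b x : qscale a (qscale b x) = qscale (a * b) x.
Proof. by case: (qprojP x) => v ->; rewrite !qscaleE scalerA. Qed.
Lemma qscale1 : left_id 1 qscale.
Proof. by move=> x; case: (qprojP x) => v ->; rewrite qscaleE scale1r. Qed.
Lemma qscaleDr : right_distributive qscale +%R.
Proof.
move=> a x y; case: (qprojP x) => v ->; case: (qprojP y) => w ->.
by rewrite -qprojD !qscaleE scalerDr qprojD.
Qed.
Lemma qscaleDl x : {morph qscale^~ x : a b / a + b}.
Proof.
by move=> a b; case: (qprojP x) => v ->; rewrite !qscaleE scalerDl qprojD.
Qed.
HB.instance Definition _ := GRing.Zmodule_isLmodule.Build R quotient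
  qscaleA qscale1 qscaleDr qscaleDl.

Lemma qproj_is_linear : linear qproj.
Proof. by move=> a v w; rewrite qprojD -qscaleE. Qed.
HB.instance Definition _ :=
  GRing.isLinear.Build R V quotient *:%R qproj qproj_is_linear.

End QuotientSpace.

(* The p-cochains form a subspace [cochain p] of an ambient space on which the
   formula for the differential makes sense. Coboundaries below are the cocycles
   that are the differential of a cochain. *)
Record cochains (R : realType) := Cochains {
  ambient : nat -> lmodType R;
  cochain : forall p, submodClosed (ambient p);
  diff : forall p, {linear ambient p -> ambient p.+1} }.

Section Cohomology.
Variables (R : realType) (C : cochains R).

Definition cocycle p : {pred ambient C p} :=
  [pred a | (a \in cochain C p) && (diff C p a == 0)].

Lemma cocycle_submod p : submod_closed (@cocycle p).
Proof.
split=> [|k a b]; rewrite !inE; first by rewrite rpred0 linear0 eqxx.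
move=> /andP[Ca /eqP da] /andP[Cb /eqP db].
by rewrite rpredD ?rpredZ //= linearP da db scaler0 addr0.
Qed.
HB.instance Definition _ p :=
  GRing.isSubmodClosed.Build R (ambient C p) (@cocycle p) (cocycle_submod p).

Record cocycles p := Cocycle {
  cocycle_val :> ambient C p;
  _ : cocycle_val \in @cocycle p }.
HB.instance Definition _ p := [isSub for @cocycle_val p].
HB.instance Definition _ p := [Choice of cocycles p by <:].
HB.instance Definition _ p := [SubChoice_isSubLmodule of cocycles p by <:].

Definition coboundary p : {pred cocycles p} :=
  match p return {pred cocycles p} with
  | 0%N => [pred z | z == 0]
  | q.+1 => [pred z |
      `[< exists2 b, b \in cochain C q & cocycle_val z = diff C q b >]]
  end.

Lemma coboundary_submod p : submod_closed (@coboundary p).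
Proof.
case: p => [|q]; split=> [|k a b]; rewrite !inE /=.
- by [].
- by move=> /eqP -> /eqP ->; rewrite scaler0 addr0.
- by exists 0; rewrite ?rpred0 // linear0.
- move=> [u Cu au] [v Cv bv].
  by exists (k *: u + v); rewrite ?rpredD ?rpredZ //= au bv linearP.
Qed.
HB.instance Definition _ p :=
  GRing.isSubmodClosed.Build R (cocycles p) (@coboundary p)
    (coboundary_submod p).

Definition cohomology (p : nat) : lmodType R := quotient (@coboundary p).

End Cohomology.

Definition graded_iso (R : realType) (H K : nat -> lmodType R) : Prop :=
  exists f : forall p, {linear H p -> K p}, forall p, bijective (f p).

Section SmoothFunctions.
Variables (R : realType) (n : nat).
Implicit Types f g : 'rV[R]_n -> R.

Definition partial_fun (i : 'I_n) f : 'rV[R]_n -> R :=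
  'D_(delta_mx 0 i) f.

Fixpoint Ck (k : nat) f : Prop :=
  match k with
  | 0 => continuous f
  | k'.+1 => (forall x, differentiable f x) /\
             (forall i, Ck k' (partial_fun i f))
  end.

Definition smooth f : Prop := forall k, Ck k f.

Lemma Ck_continuous k f : Ck k f -> continuous f.
Proof. by case: k => [//|k] [df _] x; apply: differentiable_continuous. Qed.

Lemma CkW k f : Ck k.+1 f -> Ck k f.
Proof.
elim: k f => [|k IH] f; first exact: Ck_continuous.
by move=> [df pf]; split => // i; apply: IH.
Qed.

Lemma partial_cst i c : partial_fun i (cst c) = cst 0.
Proof. by apply/funext => x; apply: derive_cst. Qed.

Lemma Ck_cst k c : Ck k (cst c).
Proof.
elim: k c => [|k IH] c /=; first exact: cst_continuous.
by split => [x|i]; [exact: differentiable_cst|rewrite partial_cst].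
Qed.

Lemma partialD i f g : (forall x, differentiable f x) ->
  (forall x, differentiable g x) ->
  partial_fun i (f + g) = partial_fun i f + partial_fun i g.
Proof.
by move=> df dg; apply/funext => x; rewrite /partial_fun deriveD //;
  apply: diff_derivable.
Qed.

Lemma CkD k f g : Ck k f -> Ck k g -> Ck k (f + g).
Proof.
elim: k f g => [|k IH] f g /=.
  by move=> cf cg x; apply: continuousD; [exact: cf|exact: cg].
move=> [df pf] [dg pg]; split=> [x|i]; first exact: differentiableD.
by rewrite partialD //; apply: IH.
Qed.

Lemma partialM i f g : (forall x, differentiable f x) ->
  (forall x, differentiable g x) ->
  partial_fun i (f * g) = partial_fun i f * g + f * partial_fun i g.
Proof.
move=> df dg; apply/funext => x.
rewrite /partial_fun deriveM; [|exact: diff_derivable|exact: diff_derivable].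
by rewrite addrC; congr (_ + _); rewrite /GRing.scale/= mulrC.
Qed.

Lemma CkM k f g : Ck k f -> Ck k g -> Ck k (f * g).
Proof.
elim: k f g => [|k IH] f g.
  by move=> /= cf cg x; apply: continuousM; [exact: cf|exact: cg].
move=> Cf Cg; have [df pf] := Cf; have [dg pg] := Cg.
split=> [x|i]; first exact: differentiableM.
rewrite partialM //; apply: CkD; apply: IH.
- exact: pf.
- exact: CkW Cg.
- exact: CkW Cf.
- exact: pg.
Qed.

Lemma smooth_cst c : smooth (cst c).
Proof. by move=> k; apply: Ck_cst. Qed.
Lemma smoothD f g : smooth f -> smooth g -> smooth (f + g).
Proof. by move=> sf sg k; apply: CkD. Qed.
Lemma smoothM f g : smooth f -> smooth g -> smooth (f * g).
Proof. by move=> sf sg k; apply: CkM. Qed.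
Lemma smooth_partial i f : smooth f -> smooth (partial_fun i f).
Proof. by move=> sf k; have [_] := sf k.+1; apply. Qed.
Lemma smooth_differentiable f x : smooth f -> differentiable f x.
Proof. by move=> /(_ 1%N)[df _]. Qed.

Definition smooth_pred : {pred 'rV[R]_n -> R} := [pred f | `[< smooth f >]].

Lemma smooth_subring : subring_closed smooth_pred.
Proof.
split=> [|f g|f g]; rewrite !inE.
- exact: smooth_cst.
- move=> sf sg.
  rewrite (_ : f - g = f + cst (-1) * g); last first.
    by apply/funext => x; rewrite /GRing.mul /= /GRing.add /= mulN1r.
  by apply: smoothD => //; apply: smoothM => //; exact: smooth_cst.
- exact: smoothM.
Qed.

Lemma smooth_scaler : GRing.scaler_closed smooth_pred.
Proof.
move=> a f; rewrite !inE => sf.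
rewrite (_ : a *: f = cst a * f) //.
by apply: smoothM => //; exact: smooth_cst.
Qed.

HB.instance Definition _ := GRing.isSubringClosed.Build ('rV[R]_n -> R)
  smooth_pred smooth_subring.
HB.instance Definition _ := GRing.isScaleClosed.Build R ('rV[R]_n -> R)
  smooth_pred smooth_scaler.

Record smoothfun := SmoothFun {
  sfval :> 'rV[R]_n -> R;
  _ : sfval \in smooth_pred }.
HB.instance Definition _ := [isSub for sfval].
HB.instance Definition _ := [Choice of smoothfun by <:].
HB.instance Definition _ := [SubChoice_isSubComNzRing of smoothfun by <:].
HB.instance Definition _ := [SubZmodule_isSubLmodule of smoothfun by <:].

Lemma sfunP (f g : smoothfun) : f =1 g <-> f = g.
Proof. by split=> [/funext/val_inj //|->]. Qed.

Lemma smooth_scalerAl (a : R) (f g : smoothfun) : a *: (f * g) = a *: f * g.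
Proof. by apply/sfunP => x; exact: mulrA. Qed.
HB.instance Definition _ :=
  GRing.Lmodule_isLalgebra.Build R smoothfun smooth_scalerAl.
HB.instance Definition _ := GRing.Lalgebra_isComAlgebra.Build R smoothfun.

Lemma smoothfunP (f : smoothfun) : smooth f.
Proof. by case: f => f /= /asboolP. Qed.

Definition mksmooth f (sf : smooth f) : smoothfun := SmoothFun (asboolT sf).

Definition partial (i : 'I_n) (f : smoothfun) : smoothfun :=
  mksmooth (smooth_partial i (smoothfunP f)).

Lemma partial_is_linear i : linear (partial i).
Proof.
move=> a f g; apply/sfunP => x.
have df y : differentiable (f : _ -> _) y.
  exact/smooth_differentiable/smoothfunP.
have dg y : differentiable (g : _ -> _) y.
  exact/smooth_differentiable/smoothfunP.
rewrite /= /partial_fun deriveD; last 2 first.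
- by apply: diff_derivable; exact: differentiableZ.
- exact: diff_derivable.
by rewrite deriveZ //; exact: diff_derivable.
Qed.
HB.instance Definition _ i :=
  GRing.isLinear.Build R smoothfun smoothfun *:%R (partial i)
    (partial_is_linear i).

Lemma partial_mul i (f g : smoothfun) :
  partial i (f * g) = partial i f * g + f * partial i g.
Proof.
apply/val_inj/partialM => x; exact/smooth_differentiable/smoothfunP.
Qed.

Lemma coord_differentiable (i : 'I_n) x :
  differentiable (fun y : 'rV[R]_n => y 0 i) x.
Proof. exact: differentiable_coord. Qed.

Lemma partial_coord_fun i j :
  partial_fun i (fun y : 'rV[R]_n => y 0 j) = cst (i == j)%:R.
Proof.
apply/funext => x; rewrite /partial_fun deriveE; last exact: differentiable_coord.
have lin : linear (fun y : 'rV[R]_n => y 0 j : R^o).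
  by move=> a u v; rewrite !mxE.
pose c := GRing.isLinear.Build _ _ _ _ _ lin.
pose F : {linear 'rV[R]_n -> R^o} := HB.pack (fun y : 'rV[R]_n => y 0 j : R^o) c.
have dF : 'd F x = F :> ('rV[R]_n -> R^o).
  apply: diff_lin => y; apply: (@differentiable_continuous _ _ _ y F).
  exact: differentiable_coord.
by rewrite [LHS](congr1 (fun h : 'rV[R]_n -> R^o => h (delta_mx 0 i)) dF) /= mxE
  eqxx eq_sym.
Qed.

Lemma smooth_coord i : smooth (fun x : 'rV[R]_n => x 0 i).
Proof.
case=> [|k] /=.
  by move=> x; apply: differentiable_continuous; exact: differentiable_coord.
split=> [x|j]; first exact: differentiable_coord.
by rewrite partial_coord_fun; apply: Ck_cst.
Qed.

Definition coord (i : 'I_n) : smoothfun := mksmooth (smooth_coord i).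

Lemma partial_coord i j : partial i (coord j) = (i == j)%:R.
Proof.
apply/val_inj; rewrite /= partial_coord_fun; apply/funext => x.
by case: (i == j).
Qed.

End SmoothFunctions.

Section VectorFields.
Variables (R : realType) (n : nat).
Local Notation Cinf := (smoothfun R n).

(* The row X stands for \sum_i (X 0 i) d/dx_i. *)
Definition vfield : Type := 'rV[Cinf]_n.
HB.instance Definition _ := GRing.Lmodule.on vfield.
Implicit Types X Y : vfield.

Definition vf_partial (i : 'I_n) : vfield := delta_mx 0 i.

Definition vf_act X (f : Cinf) : Cinf := \sum_i X 0 i * partial i f.

Definition lie_bracket X Y : vfield :=
  \row_j (vf_act X (Y 0 j) - vf_act Y (X 0 j)).

Lemma vf_act_is_linear X : linear (vf_act X).
Proof.
move=> a f g; rewrite /vf_act scaler_sumr -big_split /=.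
by apply: eq_bigr => i _; rewrite linearP mulrDr -scalerAr.
Qed.
HB.instance Definition _ X :=
  GRing.isLinear.Build R Cinf Cinf *:%R (vf_act X) (vf_act_is_linear X).

Lemma vf_actM X f g : vf_act X (f * g) = vf_act X f * g + f * vf_act X g.
Proof.
rewrite /vf_act mulr_suml mulr_sumr -big_split /=.
by apply: eq_bigr => i _; rewrite partial_mul; ring.
Qed.

Lemma vf_actDl X Y f : vf_act (X + Y) f = vf_act X f + vf_act Y f.
Proof.
rewrite /vf_act -big_split /=.
by apply: eq_bigr => i _; rewrite mxE mulrDl.
Qed.

Lemma vf_actZl (g : Cinf) X f : vf_act (g *: X) f = g * vf_act X f.
Proof.
rewrite /vf_act mulr_sumr.
by apply: eq_bigr => i _; rewrite mxE mulrA.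
Qed.

Lemma lie_bracketC X Y : lie_bracket X Y = - lie_bracket Y X.
Proof. by apply/rowP => j; rewrite !mxE opprB. Qed.

Lemma lie_bracketDr X Y Z :
  lie_bracket X (Y + Z) = lie_bracket X Y + lie_bracket X Z.
Proof.
apply/rowP => j; rewrite !mxE linearD /= vf_actDl; ring.
Qed.

Lemma lie_bracketZr X (g : Cinf) Y :
  lie_bracket X (g *: Y) = g *: lie_bracket X Y + vf_act X g *: Y.
Proof.
apply/rowP => j; rewrite !mxE vf_actM vf_actZl; ring.
Qed.

End VectorFields.

Record involutive_submodule (R : realType) (n : nat) := InvolutiveSubmodule {
  submodule :> submodClosed (vfield R n);
  involutive : forall X Y : vfield R n, X \in submodule -> Y \in submodule ->
    lie_bracket X Y \in submodule }.

Section EForms.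
Variables (R : realType) (n : nat) (E : involutive_submodule R n).
Local Notation Cinf := (smoothfun R n).

Record Efield := EField {
  Efield_val :> vfield R n;
  Efield_in : Efield_val \in submodule E }.
HB.instance Definition _ := [isSub for Efield_val].
HB.instance Definition _ := [Choice of Efield by <:].
HB.instance Definition _ := [SubChoice_isSubLmodule of Efield by <:].

Definition Ebracket (X Y : Efield) : Efield :=
  EField (involutive (Efield_in X) (Efield_in Y)).

(* For locally free E, the global sections of the p-th exterior power of the
   dual of the bundle with sections E are the alternating C^oo-multilinear maps
   E^p -> C^oo. *)
Definition multilinear p (w : ('I_p -> Efield) -> Cinf) : Prop :=
  forall (V : 'I_p -> Efield) i (f : Cinf) (X Y : Efield),
    w (dfwith V i (f *: X + Y)) = f * w (dfwith V i X) + w (dfwith V i Y).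

Definition alternating p (w : ('I_p -> Efield) -> Cinf) : Prop :=
  forall (V : 'I_p -> Efield) i j, i != j -> V i = V j -> w V = 0.

Definition Eform p : {pred ('I_p -> Efield) -> Cinf} :=
  [pred w | `[< multilinear w /\ alternating w >]].

Lemma fct_linE (T : Type) (M : lmodType R) (a : R) (w u : T -> M) (V : T) :
  (a *: w + u) V = a *: w V + u V.
Proof. by []. Qed.

Lemma Eform_submod p : submod_closed (@Eform p).
Proof.
split=> [|a w u]; rewrite !inE.
  by split=> [V i f X Y|V i j]; rewrite ?mulr0 ?addr0.
move=> [wm wa] [um ua]; split=> [V i f X Y|V i j ij Vij].
  by rewrite !fct_linE wm um scalerDr mulrDr -!scalerAr addrACA.
by rewrite fct_linE (wa _ i j) // (ua _ i j) // scaler0 addr0.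
Qed.
HB.instance Definition _ p :=
  GRing.isSubmodClosed.Build R (('I_p -> Efield) -> Cinf) (@Eform p)
    (Eform_submod p).

Definition drop1 p (V : 'I_p.+1 -> Efield) (i : 'I_p.+1) : 'I_p -> Efield :=
  fun k => V (lift i k).

(* For i < j, the p arguments [V_i, V_j], V_0, .., (no V_i), .., (no V_j), ..,
   V_p: the k-th remaining index, counting from 0, is bump j (bump i k). *)
Definition bracket_drop2 p (V : 'I_p.+1 -> Efield) (i j : 'I_p.+1) :
    'I_p -> Efield :=
  fun k => if k == 0%N :> nat then Ebracket (V i) (V j)
           else V (inord (bump j (bump i k.-1))).

Definition Ediff p (w : ('I_p -> Efield) -> Cinf) :
    ('I_p.+1 -> Efield) -> Cinf :=
  fun V =>
    \sum_(i < p.+1) (-1) ^+ i * vf_act (V i) (w (drop1 V i)) +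
    \sum_(i < p.+1) \sum_(j < p.+1 | (i < j)%N)
      (-1) ^+ (i + j) * w (bracket_drop2 V i j).

Lemma Ediff_is_linear p : linear (@Ediff p).
Proof.
move=> a w u; apply/funext => V; rewrite fct_linE /Ediff.
rewrite scalerDr addrACA !scaler_sumr; congr (_ + _); rewrite -big_split /=.
  by apply: eq_bigr => i _; rewrite fct_linE linearP /= mulrDr -scalerAr.
apply: eq_bigr => i _; rewrite scaler_sumr -big_split /=.
by apply: eq_bigr => j _; rewrite fct_linE mulrDr -scalerAr.
Qed.
HB.instance Definition _ p :=
  GRing.isLinear.Build R (('I_p -> Efield) -> Cinf)
    (('I_p.+1 -> Efield) -> Cinf) *:%R (@Ediff p) (@Ediff_is_linear p).

Definition Ecomplex : cochains R :=
  @Cochains R (fun p => ('I_p -> Efield) -> Cinf) (fun p => @Eform p)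
    (fun p => @Ediff p).

Definition Ecohomology : nat -> lmodType R := cohomology Ecomplex.

End EForms.

Section Multivectors.
Variables (R : realType) (n : nat).
Local Notation Cinf := (smoothfun R n).

(* [P S] is the coefficient of d/dx_(i1) /\ .. /\ d/dx_(ip) in P, where
   S = {i1 < .. < ip}. *)
Definition mvfield : Type := {ffun {set 'I_n} -> Cinf}.
HB.instance Definition _ := GRing.Lmodule.on mvfield.
Implicit Types P Q : mvfield.

Definition mvdeg (p : nat) : {pred mvfield} :=
  [pred P : mvfield | [forall S : {set 'I_n}, (#|S| != p) ==> (P S == 0)]].

Lemma mvdegP p P :
  reflect (forall S : {set 'I_n}, #|S| != p -> P S = 0) (P \in mvdeg p).
Proof.
apply: (iffP forallP) => [H S Sp|H S].
  by apply/eqP; move: (H S); rewrite Sp.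
by apply/implyP => Sp; apply/eqP; apply: H.
Qed.

Lemma mvdeg_submod p : submod_closed (mvdeg p).
Proof.
split=> [|a P Q /mvdegP dP /mvdegP dQ]; apply/mvdegP => S Sp; rewrite !ffunE //.
by rewrite dP // dQ // scaler0 addr0.
Qed.
HB.instance Definition _ p :=
  GRing.isSubmodClosed.Build R mvfield (mvdeg p) (mvdeg_submod p).

Definition vf_mv (X : vfield R n) : mvfield :=
  [ffun S => \sum_(i | S == [set i]) X 0 i].

(* The number of pairs to be exchanged to sort the concatenation of A and B. *)
Definition inversions (A B : {set 'I_n}) : nat :=
  #|[set ab : 'I_n * 'I_n | [&& ab.1 \in A, ab.2 \in B & (ab.2 < ab.1)%N]]|.

Definition wedge P Q : mvfield :=
  [ffun S : {set 'I_n} => \sum_(A : {set 'I_n} | A \subset S)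
    (-1) ^+ inversions A (S :\: A) * (P A * Q (S :\: A))].

Definition mv_partial (i : 'I_n) P : mvfield := [ffun S => partial i (P S)].

(* Left and right derivatives with respect to the odd variable d/dx_i. *)
Definition lcontract (i : 'I_n) P : mvfield :=
  [ffun S : {set 'I_n} => if i \in S then 0 else
    (-1) ^+ inversions [set i] S * P (i |: S)].
Definition rcontract (i : 'I_n) P : mvfield :=
  [ffun S : {set 'I_n} => if i \in S then 0 else
    (-1) ^+ inversions S [set i] * P (i |: S)].

(* The Schouten bracket as the odd Poisson bracket on functions of the x_i and
   of the odd variables d/dx_i; it extends the Lie bracket ([schouten_vf]). *)
Definition schouten P Q : mvfield :=
  \sum_i (wedge (rcontract i P) (mv_partial i Q)
          - wedge (mv_partial i P) (lcontract i Q)).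

Lemma schoutenE P Q S : schouten P Q S =
  \sum_i (wedge (rcontract i P) (mv_partial i Q) S
          - wedge (mv_partial i P) (lcontract i Q) S).
Proof. by rewrite /schouten sum_ffunE; apply: eq_bigr => i _; rewrite !ffunE. Qed.

Lemma schouten_is_linear P : linear (schouten P).
Proof.
move=> a Q Q'; apply/ffunP => S.
rewrite !ffunE !schoutenE scaler_sumr -big_split /=; apply: eq_bigr => i _.
rewrite !ffunE scalerBr !scaler_sumr addrACA -opprD -!big_split /=.
congr (_ - _); apply: eq_bigr => A _; rewrite !ffunE.
  by rewrite linearP /= !mulrDr -!scalerAr.
by case: ifP => _; rewrite ?mulr0 ?scaler0 ?addr0 // !mulrDr -!scalerAr.
Qed.
HB.instance Definition _ P :=
  GRing.isLinear.Build R mvfield mvfield *:%R (schouten P)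
    (schouten_is_linear P).

Lemma wedge_deg p q P Q :
  P \in mvdeg p -> Q \in mvdeg q -> wedge P Q \in mvdeg (p + q).
Proof.
move=> /mvdegP dP /mvdegP dQ; apply/mvdegP => S Spq; rewrite ffunE.
rewrite big1 // => A AS.
have [Ap|/dP ->] := eqVneq #|A| p; last by rewrite mul0r mulr0.
rewrite dQ ?mulr0 //; apply: contraNneq Spq => <-.
by rewrite -Ap -(cardsID A S) (finset.setIidPr AS).
Qed.

Lemma vf_mv_deg X : vf_mv X \in mvdeg 1.
Proof.
apply/mvdegP => S S1; rewrite ffunE big1 // => i /eqP Si.
by rewrite Si cards1 in S1.
Qed.

Lemma partial_deg i p P : P \in mvdeg p -> mv_partial i P \in mvdeg p.
Proof.
by move=> /mvdegP dP; apply/mvdegP => S Sp; rewrite ffunE dP // linear0.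
Qed.

Lemma lcontract_deg i p P : P \in mvdeg p.+1 -> lcontract i P \in mvdeg p.
Proof.
move=> /mvdegP dP; apply/mvdegP => S Sp; rewrite ffunE; case: ifPn => // iS.
by rewrite dP ?mulr0 // cardsU1 iS.
Qed.

Lemma rcontract_deg i p P : P \in mvdeg p.+1 -> rcontract i P \in mvdeg p.
Proof.
move=> /mvdegP dP; apply/mvdegP => S Sp; rewrite ffunE; case: ifPn => // iS.
by rewrite dP ?mulr0 // cardsU1 iS.
Qed.

End Multivectors.

Section SchoutenFacts.
Variables (R : realType) (n : nat).
Local Notation Cinf := (smoothfun R n).
Implicit Types P Q : mvfield R n.

Lemma lcontract_deg0 i P : P \in mvdeg 0 -> lcontract i P = 0.
Proof.
move=> /mvdegP dP; apply/ffunP => S; rewrite !ffunE; case: ifPn => // iS.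
by rewrite dP ?mulr0 // cardsU1 iS.
Qed.

Lemma schouten_bivector_deg p P Q :
  P \in mvdeg 2 -> Q \in mvdeg p -> schouten P Q \in mvdeg p.+1.
Proof.
move=> dP dQ; apply/mvdegP => S Sp; rewrite schoutenE big1 // => i _.
have dW : wedge (rcontract i P) (mv_partial i Q) \in mvdeg p.+1.
  by rewrite -add1n; apply: wedge_deg; [exact: rcontract_deg|exact: partial_deg].
have dW' : wedge (mv_partial i P) (lcontract i Q) \in mvdeg p.+1.
  case: p dQ {Sp dW} => [|p] dQ.
    rewrite lcontract_deg0 //; apply/mvdegP => T _; rewrite ffunE.
    by rewrite big1 // => A _; rewrite [X in _ * (_ * X)]ffunE !mulr0.
  rewrite -add2n; apply: wedge_deg; [exact: partial_deg|exact: lcontract_deg].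
by rewrite (mvdegP _ _ dW) // (mvdegP _ _ dW') // subr0.
Qed.

Lemma inversions0l (B : {set 'I_n}) : inversions finset.set0 B = 0%N.
Proof. by apply: eq_card0 => -[a b]; rewrite !inE. Qed.
Lemma inversions0r (A : {set 'I_n}) : inversions A finset.set0 = 0%N.
Proof. by apply: eq_card0 => -[a b]; rewrite !inE /= andbF. Qed.

Lemma wedge0l P Q S : P \in mvdeg 0 -> wedge P Q S = P finset.set0 * Q S.
Proof.
move=> /mvdegP dP; rewrite ffunE (bigD1 finset.set0) ?finset.sub0set //=.
rewrite inversions0l mul1r finset.setD0 big1 ?addr0 // => A /andP[_ A0].
by rewrite dP ?cards_eq0 // mul0r mulr0.
Qed.

Lemma wedge0r P Q S : Q \in mvdeg 0 -> wedge P Q S = P S * Q finset.set0.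
Proof.
move=> /mvdegP dQ; rewrite ffunE (bigD1 S) ?subxx //=.
rewrite finset.setDv inversions0r mul1r big1 ?addr0 // => A /andP[AS A0].
rewrite dQ ?mulr0 // cards_eq0 finset.setD_eq0; apply: contraNN A0 => SA.
by rewrite finset.eqEsubset AS SA.
Qed.

Lemma vf_mv1 (X : vfield R n) i : vf_mv X [set i] = X 0 i.
Proof.
rewrite ffunE (bigD1 i) //= big1 ?addr0 // => j /andP[/eqP/finset.set1_inj ->].
by rewrite eqxx.
Qed.

Lemma schouten_vf (X Y : vfield R n) :
  schouten (vf_mv X) (vf_mv Y) = vf_mv (lie_bracket X Y).
Proof.
apply/ffunP => S.
have dr i : rcontract i (vf_mv X) \in mvdeg 0 by exact/rcontract_deg/vf_mv_deg.
have dl i : lcontract i (vf_mv Y) \in mvdeg 0 by exact/lcontract_deg/vf_mv_deg.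
rewrite schoutenE; under eq_bigr do rewrite wedge0l // wedge0r //.
have [/cards1P[j ->{S}]|S1] := boolP (#|S| == 1%N); last first.
  rewrite (mvdegP _ _ (vf_mv_deg _)) // big1 // => i _.
  rewrite (mvdegP _ _ (partial_deg i (vf_mv_deg Y))) //.
  by rewrite (mvdegP _ _ (partial_deg i (vf_mv_deg X))) // mulr0 mul0r subr0.
rewrite vf_mv1 mxE /vf_act -sumrB; apply: eq_bigr => i _.
rewrite !(ffunE _ finset.set0) !inE inversions0l inversions0r finset.setU0 !mul1r.
have pE (Z : vfield R n) : mv_partial i (vf_mv Z) [set j] = partial i (Z 0 j).
  by rewrite ffunE vf_mv1.
by rewrite !pE !vf_mv1; ring.
Qed.

End SchoutenFacts.

Record poisson_structure (R : realType) (n : nat) := PoissonStructure {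
  bivector :> mvfield R n;
  bivector_deg : bivector \in mvdeg 2;
  poisson_jacobi : schouten bivector bivector = 0 }.

Definition poisson_complex (R : realType) (n : nat)
    (Pi : poisson_structure R n) : cochains R :=
  @Cochains R (fun=> mvfield R n) (fun p => @mvdeg R n p)
    (fun=> @schouten R n Pi).

Definition poisson_cohomology (R : realType) (n : nat)
    (Pi : poisson_structure R n) : nat -> lmodType R :=
  cohomology (poisson_complex Pi).

Section EulerRotation.
Variable R : realType.

Definition ix : 'I_2 := ord0.
Definition iy : 'I_2 := ord_max.
Definition xx : smoothfun R 2 := coord R ix.
Definition yy : smoothfun R 2 := coord R iy.
Definition ddx : vfield R 2 := vf_partial R ix.
Definition ddy : vfield R 2 := vf_partial R iy.

Definition v1 : vfield R 2 := xx *: ddx + yy *: ddy.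
Definition v2 : vfield R 2 := - yy *: ddx + xx *: ddy.

Definition spanE : {pred vfield R 2} :=
  [pred V | `[< exists f g : smoothfun R 2, V = f *: v1 + g *: v2 >]].

Lemma spanE_submod : submod_closed spanE.
Proof.
split=> [|h V W]; rewrite !inE.
  by exists 0, 0; rewrite !scale0r addr0.
move=> [f [g ->]] [f' [g' ->]]; exists (h * f + f'), (h * g + g').
by rewrite scalerDr !scalerA !scalerDl addrACA.
Qed.
HB.instance Definition _ :=
  GRing.isSubmodClosed.Build (smoothfun R 2) (vfield R 2) spanE spanE_submod.

Lemma partialE i (k : 'I_2) : vf_partial R i 0 k = (k == i)%:R.
Proof. by rewrite mxE eqxx. Qed.

Lemma v1x : v1 0 ix = xx. Proof. by rewrite !mxE /=; ring. Qed.
Lemma v1y : v1 0 iy = yy. Proof. by rewrite !mxE /=; ring. Qed.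
Lemma v2x : v2 0 ix = - yy. Proof. by rewrite !mxE /=; ring. Qed.
Lemma v2y : v2 0 iy = xx. Proof. by rewrite !mxE /=; ring. Qed.

Lemma vf_act2 (X : vfield R 2) f :
  vf_act X f = X 0 ix * partial ix f + X 0 iy * partial iy f.
Proof.
rewrite /vf_act big_ord_recl big_ord1.
by rewrite (_ : lift ord0 ord0 = iy) //; exact/val_inj.
Qed.

Lemma vfield2P (X Y : vfield R 2) :
  X 0 ix = Y 0 ix -> X 0 iy = Y 0 iy -> X = Y.
Proof.
move=> Xx Xy; apply/rowP => -[[|[|//]] k] //.
  by rewrite (_ : Ordinal k = ix) //; exact/val_inj.
by rewrite (_ : Ordinal k = iy) //; exact/val_inj.
Qed.

Lemma bracket_v1v2 : lie_bracket v1 v2 = 0.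
Proof.
apply: vfield2P; rewrite [LHS]mxE [RHS]mxE !vf_act2 v1x v1y v2x v2y
  ?linearN /= !partial_coord /=; ring.
Qed.

Lemma bracketvv (X : vfield R 2) : lie_bracket X X = 0.
Proof. by apply/rowP => j; rewrite !mxE subrr. Qed.

Lemma spanE_bracketr (V X : vfield R 2) (f : smoothfun R 2) : X \in spanE ->
  lie_bracket V X \in spanE -> lie_bracket V (f *: X) \in spanE.
Proof.
by move=> EX EVX; rewrite lie_bracketZr; apply: rpredD; apply: rpredZ.
Qed.

Lemma v1_spanE : v1 \in spanE.
Proof. by rewrite inE; exists 1, 0; rewrite scale1r scale0r addr0. Qed.
Lemma v2_spanE : v2 \in spanE.
Proof. by rewrite inE; exists 0, 1; rewrite scale1r scale0r add0r. Qed.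

Lemma spanE_involutive (X Y : vfield R 2) :
  X \in spanE -> Y \in spanE -> lie_bracket X Y \in spanE.
Proof.
have key V : V \in spanE -> lie_bracket V v1 \in spanE /\
    lie_bracket V v2 \in spanE.
  rewrite inE => -[f [g ->]]; split; rewrite lie_bracketC; apply: rpredNr;
    rewrite lie_bracketDr; apply: rpredD; apply: spanE_bracketr;
    rewrite ?v1_spanE ?v2_spanE ?bracketvv ?bracket_v1v2 ?rpred0 //.
  by rewrite lie_bracketC bracket_v1v2 oppr0 rpred0.
move=> EX; rewrite inE => -[f [g ->]]; have [EX1 EX2] := key X EX.
rewrite lie_bracketDr; apply: rpredD; apply: spanE_bracketr => //.
  exact: v1_spanE.
exact: v2_spanE.
Qed.

Definition E_v1v2 : involutive_submodule R 2 :=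
  @InvolutiveSubmodule R 2 spanE spanE_involutive.

(* The module is free with basis (v1, v2), hence locally free. *)
Lemma spanE_free (f g : smoothfun R 2) : f *: v1 + g *: v2 = 0 ->
  f = 0 /\ g = 0.
Proof.
move=> fg0.
have ex : f * xx - g * yy = 0.
  have := congr1 (fun V : vfield R 2 => V 0 ix) fg0.
  rewrite [X in _ = X -> _]mxE => <-.
  by rewrite !mxE /=; ring.
have ey : f * yy + g * xx = 0.
  have := congr1 (fun V : vfield R 2 => V 0 iy) fg0.
  rewrite [X in _ = X -> _]mxE => <-.
  by rewrite !mxE /=; ring.
have vanish (h : smoothfun R 2) : (xx ^+ 2 + yy ^+ 2) * h = 0 -> h = 0.
  move=> rh0.
  have h0 p : p != 0 -> h p = 0.
    move=> p0; have := congr1 (fun k : smoothfun R 2 => k p) rh0.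
    rewrite [LHS](_ : _ = (p 0 ix ^+ 2 + p 0 iy ^+ 2) * h p) //.
    move=> /eqP; rewrite mulf_eq0 => /orP[|/eqP //].
    rewrite paddr_eq0 ?sqr_ge0 // !sqrf_eq0 => /andP[/eqP px /eqP py].
    case/eqP: p0; apply/rowP => -[[|[|//]] k]; rewrite [RHS]mxE.
      by rewrite -px; congr (p _ _); exact/val_inj.
    by rewrite -py; congr (p _ _); exact/val_inj.
  apply/sfunP => p; have [->|/h0 //] := eqVneq p 0.
  have ch : {for 0, continuous (h : 'rV[R]_2 -> R)}.
    exact/differentiable_continuous/smooth_differentiable/smoothfunP.
  apply/eqP; apply: contraT => hn0.
  have nh0 : \forall q \near (0 : 'rV[R]_2), h q != 0.
    by apply: (ch [set z : R | z != 0]%classic); apply: open_nbhs_nbhs; split;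
      [exact: open_neq|].
  have [e /= e0 He] := (nbhs_ballP _ _).1 nh0.
  pose N := `|delta_mx 0 ix : 'rV[R]_2|; pose t := e / 2 / (1 + N).
  have N1 : 0 < 1 + N by rewrite ltr_pwDl // /N normr_ge0.
  have t0 : 0 < t by rewrite !divr_gt0.
  have : h (t *: delta_mx 0 ix) != 0.
    apply: He; rewrite -ball_normE /= sub0r normrN normrZ gtr0_norm // -/N.
    apply: (@lt_trans _ _ (t * (1 + N))); first by rewrite ltr_pM2l // ltrDr.
    by rewrite /t divfK ?gt_eqF // ltr_pdivrMr // ltr_pMr // ltr1n.
  rewrite h0 ?eqxx // scaler_eq0 negb_or gt_eqF //=.
  by apply/eqP => /rowP /(_ ix) /eqP; rewrite !mxE /= oner_eq0.
split; apply: vanish.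
  have -> : (xx ^+ 2 + yy ^+ 2) * f =
    xx * (f * xx - g * yy) + yy * (f * yy + g * xx) by ring.
  by rewrite ex ey !mulr0 addr0.
have -> : (xx ^+ 2 + yy ^+ 2) * g =
  xx * (f * yy + g * xx) - yy * (f * xx - g * yy) by ring.
by rewrite ex ey !mulr0 subr0.
Qed.

Definition PiE_mv : mvfield R 2 := wedge (vf_mv v1) (vf_mv v2).

Lemma PiE_deg : PiE_mv \in mvdeg 2.
Proof. exact: (wedge_deg (vf_mv_deg v1) (vf_mv_deg v2)). Qed.

Lemma PiE_jacobi : schouten PiE_mv PiE_mv = 0.
Proof.
apply/ffunP => S; rewrite [RHS]ffunE.
apply: (mvdegP _ _ (schouten_bivector_deg PiE_deg PiE_deg)).
by rewrite neq_ltn ltnS (leq_trans (max_card _)) ?card_ord.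
Qed.

Definition Pi_E : poisson_structure R 2 := PoissonStructure PiE_deg PiE_jacobi.

Lemma wedge2 (X Y : vfield R 2) : wedge (vf_mv X) (vf_mv Y) finset.setT =
  X 0 ix * Y 0 iy - X 0 iy * Y 0 ix.
Proof.
have T (i j : 'I_2) : i != j -> finset.setT :\: [set i] = [set j] :> {set 'I_2}.
  by move=> ij; apply/finset.setP => k; rewrite !inE andbT;
    case: i j k ij => [[|[|//]] ?] [[|[|//]] ?] [[|[|//]] ?].
have dX := mvdegP _ _ (vf_mv_deg X).
rewrite ffunE (bigD1 [set ix]) ?finset.subsetT //= (bigD1 [set iy]) ?finset.subsetT //=; last first.
  by apply/eqP => /finset.set1_inj.
rewrite big1 => [|A /andP[/andP[_ Ax] Ay]]; last first.
  rewrite dX ?mul0r ?mulr0 //; apply/negP => /cards1P[k Ak].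
  move: Ax Ay; rewrite Ak; case: k {Ak} => [[|[|//]] k].
    by rewrite (_ : Ordinal k = ix) ?eqxx //; exact/val_inj.
  by rewrite (_ : Ordinal k = iy) ?eqxx ?andbF //; exact/val_inj.
rewrite (T _ iy) // (T _ ix) // !vf_mv1.
rewrite (_ : inversions [set ix] [set iy] = 0%N); last first.
  by apply: eq_card0 => -[a b]; rewrite !inE /=; case: eqP => //= ->; rewrite ltn0 andbF.
rewrite (_ : inversions [set iy] [set ix] = 1%N); last first.
  rewrite /inversions (_ : finset _ = [set (iy, ix)]) ?cards1 //.
  apply/finset.setP => -[a b]; rewrite !inE /= -pair_eqE /=.
  by case: eqP => //= ->; case: eqP => //= ->.
by rewrite expr0 expr1; ring.
Qed.

Lemma PiE_coord S :
  PiE_mv S = (xx ^+ 2 + yy ^+ 2) * wedge (vf_mv ddx) (vf_mv ddy) S.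
Proof.
have [S2|S2] := boolP (#|S| == 2%N).
  have -> : S = finset.setT.
    by apply/eqP; rewrite finset.eqEcard finset.subsetT /= cardsT card_ord (eqP S2).
  by rewrite !wedge2 v1x v1y v2x v2y !partialE /=; ring.
rewrite (mvdegP _ _ PiE_deg) // (mvdegP 2 _ _) ?mulr0 //.
exact: (wedge_deg (vf_mv_deg _) (vf_mv_deg _)).
Qed.

End EulerRotation.

(* Main.v *)
From HB Require Import structures.
Require Import Defs.
From mathcomp Require Import all_boot all_order all_algebra.
From mathcomp Require Import all_classical all_reals all_analysis.
From mathcomp Require Import ring.

(** In degree two the cohomology of the module spanned by [v1] and [v2] has
    dimension at most one, while the Poisson cohomology has dimension at
    least two.

    A two-form [w] is determined by its value [f] on the frame [(v1, v2)].
    Because [v1] and [v2] commute, the differential of [g] times the second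
    dual frame element has value [v1 g]. Now [v1] is the Euler field, and the
    equation [v1 g = f] has a smooth solution as soon as [f] vanishes at the
    origin ([euler_surjective]): formally [g x] is the integral of
    [f (t x) / t] over [0 <= t <= 1]. To see that [g] is smooth, [f] is first
    written as a sum of coordinates times radial means of its partial
    derivatives (Hadamard); a second radial mean inverts the operator
    [1 + v1], and radial means of smooth functions are smooth by
    differentiation under the integral sign ([rmean_smooth]). So the class
    of [w] depends on [f 0] only ([form2_exact]), and any two classes are
    linearly dependent ([Eclass_dep]).

    On the Poisson side every bivector is a cocycle, and the coboundary of
    a vector field [Q] has coefficient [r^2 div Q - Q (r^2)] with
    [r^2 = x^2 + y^2]. Both the value at the origin and the Laplacian at the
    origin of this function are zero ([coboundary_jet]), whereas they
    separate the constant 1 from [r^2]. Hence the classes of 1 and [r^2] are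
    linearly independent ([pclass_indep]), which no surjective linear map
    from the other cohomology allows. *)

Set Implicit Arguments.
Unset Strict Implicit.
Unset Printing Implicit Defensive.

Import Order.TTheory GRing.Theory Num.Theory.
Import numFieldNormedType.Exports.
Local Open Scope ring_scope.

(** * Integrals over the unit interval *)

Local Open Scope classical_set_scope.

Section UnitIntegral.
Variable R : realType.
Implicit Types f g F : R -> R.

Definition int01 f : R := \int[lebesgue_measure]_(t in `[0, 1]) f t.

Lemma integrable01 f : continuous f ->
  (lebesgue_measure : measure _ R).-integrable `[0, 1] (EFin \o f).
Proof.
move=> cf; apply: continuous_compact_integrable; first exact: segment_compact.
exact: continuous_subspaceT.
Qed.

Lemma int01D f g : continuous f -> continuous g ->
  int01 (fun t => f t + g t) = int01 f + int01 g.
Proof. by move=> cf cg; apply: RintegralD => //; exact: integrable01. Qed.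

Lemma int01B f g : continuous f -> continuous g ->
  int01 (fun t => f t - g t) = int01 f - int01 g.
Proof. by move=> cf cg; apply: RintegralB => //; exact: integrable01. Qed.

Lemma int01Z a f : continuous f -> int01 (fun t => a * f t) = a * int01 f.
Proof. by move=> cf; apply: RintegralZl => //; exact: integrable01. Qed.

Lemma continuous_sum (T : topologicalType) (I : Type) (r : seq I) (F : I -> T -> R) :
  (forall i, continuous (F i)) -> continuous (fun t => \sum_(i <- r) F i t).
Proof.
move=> cF; elim: r => [|i r IH].
  rewrite (_ : (fun _ => _) = cst 0); first exact: cst_continuous.
  by apply/funext => t; rewrite big_nil.
rewrite (_ : (fun _ => _) = fun t => F i t + \sum_(j <- r) F j t); last first.
  by apply/funext => t; rewrite big_cons.
by move=> t; apply: cvgD; [exact: cF|exact: IH].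
Qed.

Lemma int01_sum (I : Type) (r : seq I) (F : I -> R -> R) :
  (forall i, continuous (F i)) ->
  int01 (fun t => \sum_(i <- r) F i t) = \sum_(i <- r) int01 (F i).
Proof.
move=> cF; elim: r => [|i r IH].
  rewrite big_nil /int01 (_ : (fun _ => _) = cst 0).
    by rewrite Rintegral_cst // mul0r.
  by apply/funext => t; rewrite big_nil.
rewrite big_cons -IH -int01D //; last exact: continuous_sum.
by congr int01; apply/funext => t; rewrite big_cons.
Qed.

Lemma int01_norm_le f (e : R) : continuous f ->
  (forall t : R, 0 <= t <= 1 -> `|f t| <= e) -> `|int01 f| <= e.
Proof.
move=> cf fe; apply: (le_trans (le_normr_Rintegral _ (integrable01 cf))) => //.
have -> : e = int01 (cst e).
  rewrite /int01 Rintegral_cst //.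
  have := lebesgue_measure_itv (`[0, 1]%R : interval R).
  by rewrite /= lte_fin ltr01 sube0 => -> /=; rewrite mulr1.
rewrite /int01; apply: le_Rintegral => //.
- apply: (@integrable01 (fun t => `|f t|)) => t.
  by apply: continuous_comp; [exact: cf|exact: norm_continuous].
- by apply: integrable01; exact: cst_continuous.
Qed.

Lemma int01_FTC F f : continuous f -> (forall t : R, is_derive t 1 F (f t)) ->
  int01 f = F 1 - F 0.
Proof.
move=> cf dF; have cF : continuous F.
  move=> t; apply/differentiable_continuous/derivable1_diffP.
  exact: (@ex_derive _ _ _ _ _ _ _ (dF t)).
rewrite /int01 /Rintegral (@continuous_FTC2 _ f F 0 1) //.
- exact: continuous_subspaceT.
- split => [t _||].
  + exact: (@ex_derive _ _ _ _ _ _ _ (dF t)).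
  + by apply: cvg_at_right_filter; exact: cF.
  + by apply: cvg_at_left_filter; exact: cF.
- move=> t _; rewrite derive1E.
  exact: (@derive_val _ _ _ _ _ _ _ (dF t)).
Qed.

End UnitIntegral.

(** * Radial means of smooth functions *)

Section RadialMean.
Variables (R : realType) (n : nat).
Local Notation V := 'rV[R]_n.
Implicit Types (h : V -> R) (x v y : V) (k : nat).

Lemma derive_partial h y v : differentiable h y ->
  'D_v h y = \sum_i v 0 i * partial_fun i h y.
Proof.
move=> dh; rewrite deriveE // {1}[v]row_sum_delta linear_sum.
by apply: eq_bigr => i _; rewrite linearZ /= /partial_fun deriveE.
Qed.

(** Compactness of the unit interval: continuity at each point of the
    segment from 0 to [x] becomes uniform along the whole segment when
    the far endpoint moves. This is what lets limits pass under the
    integral defining [rmean]. *)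
Lemma near_uniform01 h x (e : R) : continuous h -> 0 < e ->
  \forall y \near x, forall t : R, 0 <= t <= 1 ->
    `|h (t *: y) - h (t *: x)| < e.
Proof.
move=> ch e0.
have key (t : R) : `[0, 1] t ->
    \forall t' \near t & y \near x, `|h (t' *: y) - h (t' *: x)| < e.
  move=> _.
  pose k (p : R * V) := h (p.1 *: p.2) - h (p.1 *: x).
  have ck : {for (t, x), continuous k}.
    apply: continuousB.
      apply: (@continuous_comp _ _ _ (fun p : R * V => p.1 *: p.2) h) => /=;
        last exact: ch.
      by apply: continuousZ; [exact: cvg_fst|exact: cvg_snd].
    apply: (@continuous_comp _ _ _ (fun p : R * V => p.1 *: x) h) => /=;
      last exact: ch.
    by apply: continuousZr_tmp; exact: cvg_fst.
  have : \forall p \near (t, x), `|k (t, x) - k p| < e.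
    by move: ck => /cvgrPdist_lt; apply.
  rewrite /k /= subrr.
  case=> -[/= P Q] [nP nQ] PQ; exists (P, Q) => // -[t' y] /= [Pt Qy].
  by have := PQ (t', y) (conj Pt Qy); rewrite /= sub0r normrN.
have := (compact_near_coveringP _).1 (@segment_compact R 0 1) V (nbhs x)
  (fun y t => `|h (t *: y) - h (t *: x)| < e) (nbhs_filter x) key.
by apply: filterS => y A t t01; apply: A; rewrite /= in_itv.
Qed.

Lemma continuous_radial h x : continuous h -> continuous (fun t : R => h (t *: x)).
Proof.
move=> ch t; apply: (@continuous_comp _ _ _ (fun t : R => t *: x) h); last exact: ch.
by apply: continuousZr_tmp.
Qed.

(** The weights [t ^+ k] appear because differentiating [h (t *: x)] in
    [x] produces a factor [t]; the family indexed by [k] is closed under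
    partial derivatives. *)
Definition rmean k h x : R := int01 (fun t => t ^+ k * h (t *: x)).

Lemma continuous_rmean_integrand k h x : continuous h ->
  continuous (fun t : R => t ^+ k * h (t *: x)).
Proof.
move=> ch t.
apply: (@continuousM _ _ (fun t : R => t ^+ k) (fun t : R => h (t *: x))).
  exact: exprn_continuous.
exact: continuous_radial.
Qed.

Lemma rmean_continuous k h : continuous h -> continuous (rmean k h).
Proof.
move=> ch x; apply/(@cvgrPdist_le _ _ _ (nbhs x) (nbhs_filter x)) => e e0.
apply: filterS (near_uniform01 x ch e0) => y hxy.
rewrite /rmean -int01B; try exact: continuous_rmean_integrand.
apply: int01_norm_le => [t|t t01].
  by apply: cvgB; exact: continuous_rmean_integrand.
have /andP[t0 t1] := t01.
rewrite -mulrBr normrM ger0_norm ?exprn_ge0 // -[leRHS]mul1r.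
apply: ler_pM; rewrite ?exprn_ge0 ?exprn_ile1 // distrC ltW //.
exact: hxy.
Qed.

(** The difference quotients of both sides are the same function, so no
    chain rule is needed. *)
Lemma is_derive_line h x v (s : R) : differentiable h (x + s *: v) ->
  is_derive s (1 : R) (fun s : R => h (x + s *: v)) ('D_v h (x + s *: v)).
Proof.
move=> dh; pose l (s : R) := h (x + s *: v).
have E : (fun e : R => e^-1 *: ((l \o shift s) (e *: (1 : R)) - l s)) =
         (fun e : R => e^-1 *: ((h \o shift (x + s *: v)) (e *: v) - h (x + s *: v))).
  apply/funext => e; rewrite /l /=; congr (_ *: (h _ - _)).
  by rewrite scalerDl [e *: 1]mulr1 addrCA.
have dhv : derivable h (x + s *: v) v by exact: diff_derivable.
apply: DeriveDef; first by rewrite /derivable [X in X @ _]E.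
by rewrite /derive [X in X @ _]E.
Qed.

(** First-order Taylor estimate with a remainder uniform along the
    segment from 0 to [x]: the mean value theorem on the segment from [t
    *: x] to [t *: (x + v)] replaces the increment by a derivative at an
    intermediate point, and [near_uniform01] compares it with the
    derivative at [t *: x]. *)
Lemma near_remainder h x (e : R) : (forall y, differentiable h y) ->
  (forall i, continuous (partial_fun i h)) -> 0 < e ->
  \forall v \near (0 : V), forall t : R, 0 <= t <= 1 ->
    `|h (t *: (x + v)) - h (t *: x) - t * 'D_v h (t *: x)| <= e * `|v|.
Proof.
move=> dh ch e0.
(* One share of [e] for each of the [n] coordinates; [n.+1] covers [n = 0]. *)
pose e' := e / n.+1%:R.
have e'0 : 0 < e' by rewrite divr_gt0.
have near_i : \forall y \near x, forall i (t : R), 0 <= t <= 1 ->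
    `|partial_fun i h (t *: y) - partial_fun i h (t *: x)| < e'.
  by apply: (filter_forall (nbhs_filter x)) => i; exact: near_uniform01.
have [d /= d0 xd] := (nbhs_ballP _ _).1 near_i.
apply/nbhs_ballP; exists d => //= v; rewrite -ball_normE /= sub0r normrN => vd t t01.
have /andP[t0 t1] := t01.
have [|s s01] := @MVT_segment R (fun s => h (t *: x + s *: (t *: v)))
   (fun s => 'D_(t *: v) h (t *: x + s *: (t *: v))) 0 1 ler01
   (fun s _ => is_derive_line (dh _)).
  apply: derivable_within_continuous => s _.
  exact: (@ex_derive _ _ _ _ _ _ _ (is_derive_line (dh _))).
rewrite scale1r scale0r addr0 subr0 mulr1 -scalerDr => ->.
rewrite !derive_partial // mulr_sumr -sumrB.
have -> : t *: x + s *: (t *: v) = t *: (x + s *: v).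
  by rewrite scalerDr !scalerA mulrC.
apply: (@le_trans _ _ (\sum_(i < n) e' * `|v|)); last first.
  have eE : e = e' * n.+1%:R by rewrite divfK.
  rewrite sumr_const card_ord -[leLHS]mulr_natr [in leRHS]eE [leRHS]mulrAC.
  by apply: ler_wpM2l; rewrite ?ler_nat // mulr_ge0 // ltW.
apply: le_trans (ler_norm_sum _ _ _) _; apply: ler_sum => i _.
rewrite mxE mulrA -mulrBr normrM mulrC; apply: ler_pM => //.
  apply/ltW/xd => //; rewrite -ball_normE /= opprD addNKr normrN normrZ.
  apply: le_lt_trans vd; rewrite ler_piMl //.
  by move: s01; rewrite in_itv /= => /andP[s0 s1]; rewrite ger0_norm.
rewrite normrM ger0_norm //; apply: (@le_trans _ _ `|v 0 i|).
  by rewrite ler_piMl.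
rewrite [leRHS]/Num.Def.normr /= mx_normrE.
by apply/bigmax_geP; right => /=; exists (0, i).
Qed.

Lemma differentiable_expansion h x (L : {linear V -> R^o}) :
  continuous L ->
  (forall e : R, 0 < e ->
    \forall v \near (0 : V), `|h (x + v) - h x - L v| <= e * `|v|) ->
  differentiable h x /\ 'd h x = L :> (V -> R).
Proof.
move=> cL near_e.
have E : h \o shift x = cst (h x) + (L : V -> R) +o_ (0 : V) id.
  apply/eqaddoP => e e0; apply: filterS (near_e e e0) => v.
  rewrite (_ : (_ - _) v = h (x + v) - h x - L v) //.
  by rewrite [x + v]addrC -addrA -opprD.
have dL : 'd h x = L :> (V -> R) by exact: (@diff_unique _ _ _ h L x cL E).
by split => //; apply/diff_locallyP; rewrite dL.
Qed.

(** Differentiation under the integral sign: integrating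
    [near_remainder] over [t] bounds the remainder of [rmean k h] by an
    arbitrarily small multiple of the norm of the increment. Real
    differentiability, and not only the existence of partial
    derivatives, is what [Ck] asks for. *)
Lemma rmean_diff k h x : (forall y, differentiable h y) ->
  (forall i, continuous (partial_fun i h)) ->
  differentiable (rmean k h) x /\
  forall v, 'D_v (rmean k h) x = \sum_i v 0 i * rmean k.+1 (partial_fun i h) x.
Proof.
move=> dh ch; pose c i := rmean k.+1 (partial_fun i h) x.
have hc : continuous h by move=> y; exact: differentiable_continuous.
have lin : linear (fun v : V => \sum_i v 0 i * c i : R^o).
  move=> a u v; rewrite scaler_sumr -big_split; apply: eq_bigr => i _ /=.
  by rewrite !mxE mulrDl -mulrA.
pose L : {linear V -> R^o} :=
  HB.pack (fun v : V => \sum_i v 0 i * c i : R^o) (GRing.isLinear.Build _ _ _ _ _ lin).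
have cL : continuous L.
  apply: continuous_sum => i v.
  apply: (@continuousM _ _ (fun v : V => v 0 i) (fun=> c i)).
    exact: coord_continuous.
  exact: cst_continuous.
have [|dm Dm] := @differentiable_expansion (rmean k h) x L cL; last first.
  by split=> // v; rewrite deriveE // Dm.
move=> e e0; apply: filterS (near_remainder x dh ch e0) => v hv.
have integrandE t : t ^+ k * (t * 'D_v h (t *: x)) =
    \sum_i v 0 i * (t ^+ k.+1 * partial_fun i h (t *: x)).
  rewrite derive_partial // mulrA -exprSr mulr_sumr.
  by apply: eq_bigr => i _; ring.
have ci i : continuous (fun t : R => v 0 i * (t ^+ k.+1 * partial_fun i h (t *: x))).
  by move=> t; apply: cvgM; [exact: cst_continuous|exact: continuous_rmean_integrand].
have cD : continuous (fun t : R => t ^+ k * (t * 'D_v h (t *: x))).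
  by rewrite (funext integrandE); exact: continuous_sum.
have LE : L v = int01 (fun t => t ^+ k * (t * 'D_v h (t *: x))).
  rewrite (funext integrandE) int01_sum //; apply: eq_bigr => i _.
  by rewrite int01Z //; exact: continuous_rmean_integrand.
rewrite LE /rmean -!int01B //; try exact: continuous_rmean_integrand; last first.
  by move=> t; apply: cvgB; exact: continuous_rmean_integrand.
apply: int01_norm_le => [t|t t01].
  by apply: cvgB; [apply: cvgB; exact: continuous_rmean_integrand|exact: cD].
have /andP[t0 t1] := t01.
rewrite -!mulrBr normrM ger0_norm ?exprn_ge0 // -[leRHS]mul1r.
by apply: ler_pM; rewrite ?exprn_ge0 ?exprn_ile1 //; exact: hv.
Qed.

Lemma partial_rmean k h i : (forall y, differentiable h y) ->
  (forall i, continuous (partial_fun i h)) ->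
  partial_fun i (rmean k h) = rmean k.+1 (partial_fun i h).
Proof.
move=> dh ch; apply/funext => x; have [_ D] := rmean_diff k x dh ch.
rewrite /partial_fun D (bigD1 i) //= mxE !eqxx mul1r big1 ?addr0 // => j ji.
by rewrite mxE (negPf ji) andbF mul0r.
Qed.

(** Induction on [m], for all [k] at once: the partial derivatives of
    [rmean k h] are radial means of the partial derivatives of [h], with
    weight [k.+1]. *)
Lemma rmean_Ck m k h : Ck m h -> Ck m (rmean k h).
Proof.
elim: m k h => [|m IH] k h; first exact: rmean_continuous.
move=> [dh Ch].
have ch i : continuous (partial_fun i h) by exact: Ck_continuous (Ch i).
split=> [x|i]; first by have [] := rmean_diff k x dh ch.
by rewrite partial_rmean //; apply: IH; exact: Ch.
Qed.

Lemma rmean_smooth k h : smooth h -> smooth (rmean k h).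
Proof. by move=> sh m; apply: rmean_Ck. Qed.

Lemma is_derive_ray h x (t : R) : differentiable h (t *: x) ->
  is_derive t (1 : R) (fun t : R => h (t *: x)) ('D_x h (t *: x)).
Proof.
move=> dh; have := @is_derive_line h 0 x t; rewrite add0r => /(_ dh).
by rewrite (_ : (fun s : R => h (0 + s *: x)) = (fun s : R => h (s *: x))) //;
  apply/funext => s; rewrite add0r.
Qed.

(** Fundamental theorem of calculus for [h (t *: x)] on the unit
    interval. *)
Lemma hadamard h x : (forall y, differentiable h y) ->
  (forall i, continuous (partial_fun i h)) ->
  h x - h 0 = \sum_i x 0 i * rmean 0 (partial_fun i h) x.
Proof.
move=> dh ch.
have cp i : continuous (fun t : R => x 0 i * (t ^+ 0 * partial_fun i h (t *: x))).
  by move=> t; apply: cvgM; [exact: cst_continuous|exact: continuous_rmean_integrand].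
have DE t : 'D_x h (t *: x) = \sum_i x 0 i * (t ^+ 0 * partial_fun i h (t *: x)).
  by rewrite derive_partial //; apply: eq_bigr => i _; rewrite mul1r.
have := @int01_FTC R (fun t => h (t *: x)) (fun t => 'D_x h (t *: x)) _
  (fun t => is_derive_ray (dh _)).
rewrite scale1r scale0r => <-; last first.
  by rewrite (funext DE); exact: continuous_sum.
rewrite (funext DE) int01_sum //; apply: eq_bigr => i _.
by rewrite int01Z //; exact: continuous_rmean_integrand.
Qed.

(** Fundamental theorem of calculus for [t * h (t *: x)]: the operator
    [rmean 0] is a right inverse of one plus the Euler derivation. *)
Lemma euler_rmean h x : (forall y, differentiable h y) ->
  (forall i, continuous (partial_fun i h)) ->
  rmean 0 h x + \sum_i x 0 i * partial_fun i (rmean 0 h) x = h x.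
Proof.
move=> dh ch.
have hc : continuous h by move=> y; exact: differentiable_continuous.
have cp i : continuous (fun t : R => x 0 i * (t ^+ 1 * partial_fun i h (t *: x))).
  by move=> t; apply: cvgM; [exact: cst_continuous|exact: continuous_rmean_integrand].
pose f (t : R) := t ^+ 0 * h (t *: x) + \sum_i x 0 i * (t ^+ 1 * partial_fun i h (t *: x)).
have cf : continuous f.
  by move=> t; apply: cvgD; [exact: continuous_rmean_integrand|exact: continuous_sum].
have dF (t : R) : is_derive t (1 : R) (fun t : R => t * h (t *: x)) (f t).
  apply: is_derive_eq (is_deriveM (is_derive_id _ _) (is_derive_ray (dh _))) _.
  rewrite /f derive_partial // [_ *: 1]mulr1 mul1r addrC; congr (_ + _).
  rewrite [LHS]mulr_sumr; apply: eq_bigr => i _; rewrite expr1; ring.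
have := int01_FTC cf dF; rewrite scale1r mul1r mul0r subr0 => <-.
rewrite /f int01D //; last exact: continuous_sum.
  rewrite int01_sum //; congr (_ + _); apply: eq_bigr => i _.
  by rewrite partial_rmean // int01Z //; exact: continuous_rmean_integrand.
exact: continuous_rmean_integrand.
Qed.

End RadialMean.

Local Close Scope classical_set_scope.

(** * Surjectivity of the Euler field *)

Section Euler.
Variables (R : realType) (n : nat).
Local Notation Cinf := (smoothfun R n).
Implicit Types f g : Cinf.

Definition euler : vfield R n := \row_i Defs.coord R i.

Definition smooth_rmean f : Cinf := mksmooth (rmean_smooth 0 (smoothfunP f)).

Lemma smoothfun_diff f y : differentiable f y.
Proof. exact/smooth_differentiable/smoothfunP. Qed.

Lemma partial_continuous i f : continuous (partial_fun i f).
Proof. exact/(@Ck_continuous _ _ 0)/smooth_partial/smoothfunP. Qed.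

Lemma sfun_sum (I : Type) (r : seq I) (F : I -> Cinf) x :
  (\sum_(i <- r) F i) x = \sum_(i <- r) F i x.
Proof. by elim: r => [|i r IH]; rewrite ?big_nil // !big_cons -IH. Qed.

Lemma act_euler_coord i : vf_act euler (Defs.coord R i) = Defs.coord R i.
Proof.
rewrite /vf_act (bigD1 i) //= partial_coord eqxx mulr1 mxE big1 ?addr0 // => j ji.
by rewrite partial_coord (negPf ji) mulr0.
Qed.

Lemma act_euler_rmean f :
  smooth_rmean f + vf_act euler (smooth_rmean f) = f.
Proof.
apply/sfunP => x; rewrite /= -[RHS](euler_rmean x (smoothfun_diff f)); last first.
  by move=> i; exact: partial_continuous.
rewrite /vf_act; congr (_ + _); rewrite sfun_sum; apply: eq_bigr => i _.
by rewrite mxE.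
Qed.

(** By [hadamard], [f] is the sum of [x_i * u_i] with [u_i] the radial
    mean of the [i]-th partial derivative. The Euler derivation fixes
    each [x_i], so it sends [x_i * w] to [x_i] times the image of [w]
    under one plus the derivation; by [act_euler_rmean] one can take for
    [w] the radial mean of [u_i]. *)
Lemma euler_surjective f : f 0 = 0 -> exists g, vf_act euler g = f.
Proof.
move=> f0; exists (\sum_i Defs.coord R i * smooth_rmean (smooth_rmean (partial i f))).
rewrite linear_sum; apply/sfunP => x /=.
have := hadamard x (smoothfun_diff f) (fun i => @partial_continuous i f).
rewrite f0 subr0 => ->; rewrite sfun_sum; apply: eq_bigr => i _.
by rewrite vf_actM act_euler_coord -mulrDr act_euler_rmean.
Qed.

End Euler.

(** * Commuting frames *)

Lemma scale_comb (K : pzRingType) (L : lmodType K) (u w : L) (f a b a' b' : K) :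
  f *: (a *: u + b *: w) + (a' *: u + b' *: w) = (f * a + a') *: u + (f * b + b') *: w.
Proof. by rewrite scalerDr !scalerA addrACA -!scalerDl. Qed.

Section CommutingFrame.
Variables (R : realType) (n : nat).
Implicit Types (U W X : vfield R n).

Lemma vf_act_comb U W (a b f : smoothfun R n) :
  vf_act (a *: U + b *: W) f = a * vf_act U f + b * vf_act W f.
Proof. by rewrite vf_actDl 2!vf_actZl. Qed.

Lemma comb_coef U W (f g : smoothfun R n) j :
  (f *: U + g *: W) 0 j = f * U 0 j + g * W 0 j.
Proof. by rewrite mxE; congr (_ + _); rewrite mxE. Qed.

Lemma vf_actM_comb X (f g h k : smoothfun R n) : vf_act X (f * g + h * k) =
  vf_act X f * g + f * vf_act X g + (vf_act X h * k + h * vf_act X k).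
Proof. by rewrite linearD /= 2!vf_actM. Qed.

(** Compare coordinates: the terms where [U] or [W] is itself
    differentiated cancel, those with [U (W j)] against those with [W (U
    j)] because the frame commutes, and only the derivatives of the
    coefficients remain. *)
Lemma lie_bracket_commuting_frame U W X Y (a b a' b' : smoothfun R n) :
  lie_bracket U W = 0 -> X = a *: U + b *: W -> Y = a' *: U + b' *: W ->
  lie_bracket X Y = (vf_act X a' - vf_act Y a) *: U + (vf_act X b' - vf_act Y b) *: W.
Proof.
move=> UW XE YE; apply/rowP => j.
have UWj : vf_act U (W 0 j) = vf_act W (U 0 j).
  apply/eqP; rewrite -subr_eq0; apply/eqP.
  by have := congr1 (fun Z : vfield R n => Z 0 j) UW; rewrite mxE => ->; rewrite mxE.
have Xj : X 0 j = a * U 0 j + b * W 0 j by rewrite XE; exact: comb_coef.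
have Yj : Y 0 j = a' * U 0 j + b' * W 0 j by rewrite YE; exact: comb_coef.
have Xf f : vf_act X f = a * vf_act U f + b * vf_act W f by rewrite XE; exact: vf_act_comb.
have Yf f : vf_act Y f = a' * vf_act U f + b' * vf_act W f by rewrite YE; exact: vf_act_comb.
transitivity (vf_act X (Y 0 j) - vf_act Y (X 0 j)); first by rewrite mxE.
apply: etrans (esym (comb_coef _ _ _ _ _)).
rewrite Xj Yj 2!vf_actM_comb.
rewrite (Xf (U 0 j)) (Xf (W 0 j)) (Yf (U 0 j)) (Yf (W 0 j)) UWj.
ring.
Qed.

End CommutingFrame.

(** * The forms of the module spanned by v1 and v2 *)

Section EllipticForms.
Variable R : realType.
Local Notation Cinf := (smoothfun R 2).
Local Notation E := (E_v1v2 R).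
Implicit Types (X Y : Efield E) (f g : Cinf).

Definition Ev1 : Efield E := @EField R 2 E (v1 R) (v1_spanE R).
Definition Ev2 : Efield E := @EField R 2 E (v2 R) (v2_spanE R).

Lemma frame_decomp X : exists c : Cinf * Cinf, X = c.1 *: Ev1 + c.2 *: Ev2.
Proof.
have := Efield_in X; rewrite inE => -[f [g Xfg]].
by exists (f, g); apply/val_inj.
Qed.

(** Coordinates in the frame [(v1, v2)]; the choice is harmless since
    the frame is free ([frame_coef_unique]). *)
Definition frame_coef X : Cinf * Cinf := projT1 (cid (frame_decomp X)).

Lemma frame_coefE X : X = (frame_coef X).1 *: Ev1 + (frame_coef X).2 *: Ev2.
Proof. by rewrite /frame_coef; case: cid. Qed.

Lemma frame_coef_val X : Efield_val X = (frame_coef X).1 *: v1 R + (frame_coef X).2 *: v2 R.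
Proof. by rewrite {1}[X]frame_coefE. Qed.

Lemma frame_coef_unique X f g : Efield_val X = f *: v1 R + g *: v2 R -> frame_coef X = (f, g).
Proof.
move=> XE.
have /spanE_free[/eqP] : ((frame_coef X).1 - f) *: v1 R + ((frame_coef X).2 - g) *: v2 R = 0.
  have -> : 0 = Efield_val X - (f *: v1 R + g *: v2 R) by rewrite XE subrr.
  rewrite {1}(frame_coef_val X) opprD addrACA.
  by congr (_ + _); rewrite scalerBl.
by rewrite subr_eq0 => /eqP <- /eqP; rewrite subr_eq0 => /eqP <-; case: (frame_coef X).
Qed.

Lemma vf_act_v1 f : vf_act (v1 R) f = vf_act (euler R 2) f.
Proof.
congr (vf_act _ f); apply: vfield2P; rewrite [RHS]mxE; [exact: v1x|exact: v1y].
Qed.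

Lemma vf_act_frame X f :
  vf_act X f = (frame_coef X).1 * vf_act (v1 R) f + (frame_coef X).2 * vf_act (v2 R) f.
Proof. by rewrite {1}(frame_coef_val X); exact: vf_act_comb. Qed.

Lemma frame_coef_bracket X Y : (frame_coef (Ebracket X Y)).2 =
  vf_act X (frame_coef Y).2 - vf_act Y (frame_coef X).2.
Proof.
apply: (congr1 snd (frame_coef_unique _)).
exact: lie_bracket_commuting_frame (bracket_v1v2 R) (frame_coef_val X) (frame_coef_val Y).
Qed.

Definition pair2 X Y : 'I_2 -> Efield E := fun k => if k == ord0 then X else Y.

Lemma pair2E (V : 'I_2 -> Efield E) : V = pair2 (V ix) (V iy).
Proof.
apply/funext => -[[|[|//]] k]; rewrite /pair2 /=; congr V; exact/val_inj.
Qed.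

Lemma dfwith_pair2l X Y Z : dfwith (pair2 X Y) ix Z = pair2 Z Y.
Proof. by rewrite [LHS]pair2E dfwithin dfwithout. Qed.

Lemma dfwith_pair2r X Y Z : dfwith (pair2 X Y) iy Z = pair2 X Z.
Proof. by rewrite [LHS]pair2E dfwithin dfwithout. Qed.

Section TwoForm.
Context (w : ('I_2 -> Efield E) -> Cinf) (Ew : w \in @Eform R 2 E 2).

Lemma form2_lin i (V : 'I_2 -> Efield E) f g X Y :
  w (dfwith V i (f *: X + g *: Y)) = f * w (dfwith V i X) + g * w (dfwith V i Y).
Proof.
move: Ew; rewrite inE => -[wm _].
have w0 : w (dfwith V i 0) = 0.
  apply: (@addrI _ (w (dfwith V i 0))); rewrite addr0 -{1}[w (dfwith V i 0)]mul1r.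
  by rewrite -wm scaler0 addr0.
by rewrite wm -[g *: Y]addr0 wm w0 addr0.
Qed.

Lemma form2_alt X : w (pair2 X X) = 0.
Proof. by move: Ew; rewrite inE => -[_ /(_ (pair2 X X) ix iy)]; apply. Qed.

Lemma form2_lin_l f g X X' Y :
  w (pair2 (f *: X + g *: X') Y) = f * w (pair2 X Y) + g * w (pair2 X' Y).
Proof. by have := form2_lin ix (pair2 X Y) f g X X'; rewrite 3!dfwith_pair2l. Qed.

Lemma form2_lin_r f g X Y Y' :
  w (pair2 X (f *: Y + g *: Y')) = f * w (pair2 X Y) + g * w (pair2 X Y').
Proof. by have := form2_lin iy (pair2 X Y) f g Y Y'; rewrite 3!dfwith_pair2r. Qed.

Lemma form2_expand a b a' b' : w (pair2 (a *: Ev1 + b *: Ev2) (a' *: Ev1 + b' *: Ev2)) =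
  a * (b' * w (pair2 Ev1 Ev2)) + b * (a' * w (pair2 Ev2 Ev1)).
Proof.
rewrite (form2_lin_l a b Ev1 Ev2) (form2_lin_r a' b' Ev1 Ev1 Ev2).
rewrite (form2_lin_r a' b' Ev2 Ev1 Ev2).
by rewrite (form2_alt Ev1) (form2_alt Ev2) 2!mulr0 addr0 add0r.
Qed.

Lemma form2_antisym : w (pair2 Ev2 Ev1) = - w (pair2 Ev1 Ev2).
Proof.
apply/eqP; rewrite -addr_eq0 addrC; apply/eqP.
by rewrite -[RHS](form2_alt (1 *: Ev1 + 1 *: Ev2)) form2_expand !mul1r.
Qed.

(** A two-form on a module of rank two is determined by its value on the
    frame, multiplied by the determinant of the coordinates. *)
Lemma form2E V : w V = ((frame_coef (V ix)).1 * (frame_coef (V iy)).2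
    - (frame_coef (V ix)).2 * (frame_coef (V iy)).1) * w (pair2 Ev1 Ev2).
Proof.
rewrite {1}[V]pair2E {1}[V ix]frame_coefE {1}[V iy]frame_coefE form2_expand form2_antisym.
ring.
Qed.

End TwoForm.

Definition v2_dual g : ('I_1 -> Efield E) -> Cinf := fun V => g * (frame_coef (V ord0)).2.

Lemma v2_dual_form g : v2_dual g \in @Eform R 2 E 1.
Proof.
rewrite inE; split=> [V i f X Y|V i j]; last by rewrite !ord1.
rewrite /v2_dual ord1 !dfwithin.
rewrite (@frame_coef_unique _ (f * (frame_coef X).1 + (frame_coef Y).1)
  (f * (frame_coef X).2 + (frame_coef Y).2)).
  by rewrite /=; ring.
apply: (@etrans _ _ (f *: Efield_val X + Efield_val Y)) => //.
rewrite {1}(frame_coef_val X) {1}(frame_coef_val Y); exact: scale_comb.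
Qed.

(** The derivatives of the coordinates cancel against the bracket term,
    since the frame commutes; what remains is [v1 g] times the
    determinant of the coordinates. *)
Lemma Ediff_v2_dual g V : Ediff (v2_dual g) V =
  ((frame_coef (V ix)).1 * (frame_coef (V iy)).2 - (frame_coef (V ix)).2 * (frame_coef (V iy)).1)
  * vf_act (v1 R) g.
Proof.
have lift0 : lift ord0 ord0 = iy by exact/val_inj.
have lift1 : lift iy ord0 = ix by exact/val_inj.
rewrite /Ediff !big_ord_recl !big_ord0 /= !big_mkcond !big_ord_recl !big_ord0 /=.
rewrite /v2_dual /Defs.drop1 /bracket_drop2 /= frame_coef_bracket lift0 lift1.
rewrite 2!vf_actM (vf_act_frame (V ord0) g) (vf_act_frame (V iy) g) -/ix.
rewrite big1 => [|j]; last by rewrite ltnNge -ltnS ltn_ord.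
rewrite /bump /= !add0r !addr0 expr0 expr1 !mul1r !mulN1r.
move: (frame_coef (V ix)) (frame_coef (V iy)) => [a b] [a' b'] /=.
move: (vf_act (V ix) b') (vf_act (V iy) b) (vf_act _ g) (vf_act _ g) => p q r s.
ring.
Qed.

(** Only [v1] is used to integrate: [v1] is the Euler field, which
    reaches every function that vanishes at the origin. *)
Lemma form2_exact w : w \in @Eform R 2 E 2 -> w (pair2 Ev1 Ev2) 0 = 0 ->
  exists2 u, u \in @Eform R 2 E 1 & w = Ediff u.
Proof.
move=> Ew /euler_surjective[g gE]; exists (v2_dual g); first exact: v2_dual_form.
by apply/funext => V; rewrite (form2E Ew) Ediff_v2_dual vf_act_v1 gE.
Qed.

End EllipticForms.

(** * Poisson coboundaries in degree two *)

Section PoissonCoboundaries.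
Variable R : realType.
Local Notation Cinf := (smoothfun R 2).
Implicit Types (f g : Cinf) (P Q : mvfield R 2).

(** Puts a multivector of degree one in the form to which the lemmas on
    wedge products of vector fields apply. *)
Lemma mvdeg1_vf Q : Q \in mvdeg 1 -> Q = vf_mv (\row_i Q [set i] : vfield R 2).
Proof.
move=> /mvdegP dQ; apply/ffunP => S.
have [/cards1P[i ->]|S1] := boolP (#|S| == 1%N); first by rewrite vf_mv1 mxE.
by rewrite dQ // (mvdegP _ _ (vf_mv_deg _)).
Qed.

Lemma setU_xy (i j : 'I_2) : i != j -> i |: [set j] = finset.setT :> {set 'I_2}.
Proof.
by move=> ij; apply/finset.setP => k; rewrite !inE;
  case: i j k ij => [[|[|//]] ?] [[|[|//]] ?] [[|[|//]] ?].
Qed.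

Lemma inversions_xy : inversions [set ix] [set iy] = 0%N.
Proof.
by apply: eq_card0 => -[a b]; rewrite !inE /=; case: eqP => //= ->; rewrite ltn0 andbF.
Qed.

Lemma inversions_yx : inversions [set iy] [set ix] = 1%N.
Proof.
rewrite /inversions (_ : finset _ = [set (iy, ix)]) ?cards1 //.
apply/finset.setP => -[a b]; rewrite !inE /= -pair_eqE /=.
by case: eqP => //= ->; case: eqP => //= ->.
Qed.

Lemma rcontract_x P : P \in mvdeg 2 ->
  rcontract ix P = vf_mv (- P finset.setT *: ddy R).
Proof.
move=> dP; rewrite (mvdeg1_vf (rcontract_deg ix dP)); congr vf_mv.
apply: vfield2P; rewrite [LHS]mxE [RHS]mxE partialE /= ffunE !inE /=.
  by rewrite mulr0.
by rewrite setU_xy // inversions_yx mulr1 expr1 mulN1r.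
Qed.

Lemma rcontract_y P : P \in mvdeg 2 ->
  rcontract iy P = vf_mv (P finset.setT *: ddx R).
Proof.
move=> dP; rewrite (mvdeg1_vf (rcontract_deg iy dP)); congr vf_mv.
apply: vfield2P; rewrite [LHS]mxE [RHS]mxE partialE /= ffunE !inE /=.
  by rewrite setU_xy // inversions_xy mulr1 expr0 mul1r.
by rewrite mulr0.
Qed.

Lemma mv_partial_vf i Q : Q \in mvdeg 1 ->
  mv_partial i Q = vf_mv (\row_j partial i (Q [set j]) : vfield R 2).
Proof.
move=> dQ; rewrite (mvdeg1_vf (partial_deg i dQ)); congr vf_mv.
by apply/rowP => j; rewrite !mxE ffunE.
Qed.

(** Contracting a bivector of the plane with one coordinate leaves the
    other one, so the first half of the bracket collects the divergence
    of [Q]; in the second half [Q] is fully contracted and only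
    differentiates the coefficient of [P]. *)
Lemma schouten_bivector_vf P Q : P \in mvdeg 2 -> Q \in mvdeg 1 ->
  schouten P Q finset.setT =
    P finset.setT * (partial ix (Q [set ix]) + partial iy (Q [set iy]))
    - (Q [set ix] * partial ix (P finset.setT) + Q [set iy] * partial iy (P finset.setT)).
Proof.
move=> dP dQ; rewrite schoutenE big_ord_recl big_ord1 -/ix.
have -> : lift ord0 ord0 = iy by exact/val_inj.
rewrite rcontract_x // rcontract_y // !(mv_partial_vf _ dQ) !wedge2.
rewrite !wedge0r; try exact: lcontract_deg.
rewrite !ffunE !inE !inversions0r !finset.setU0 !mul1r !mxE /=.
ring.
Qed.

End PoissonCoboundaries.

(** * Linear relations between classes *)

Section Quotients.
Variables (R : realType) (V : lmodType R) (U : submodClosed V).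

Lemma qproj_comb0 (a b : V) (c d : R) :
  (c *: qproj U a + d *: qproj U b == 0) = (c *: a + d *: b \in U).
Proof. by rewrite -!linearZ -linearD -[X in _ == X](linear0 (qproj U)) qproj_eq subr0. Qed.

End Quotients.

(** * Two independent Poisson classes *)

Section PoissonSide.
Variable R : realType.
Local Notation Cinf := (smoothfun R 2).
Implicit Types (f g p q : Cinf) (c d : R).

(** The Laplacian; its value at the origin is the linear form that tells
    [x^2 + y^2] apart from the coboundaries. *)
Definition lap f : Cinf := partial ix (partial ix f) + partial iy (partial iy f).

Lemma partial_xx : partial ix (xx R) = 1. Proof. by rewrite partial_coord. Qed.
Lemma partial_xy : partial ix (yy R) = 0. Proof. by rewrite partial_coord. Qed.
Lemma partial_yx : partial iy (xx R) = 0. Proof. by rewrite partial_coord. Qed.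
Lemma partial_yy : partial iy (yy R) = 1. Proof. by rewrite partial_coord. Qed.
Lemma partial_1 i : partial i 1 = 0 :> Cinf.
Proof. by apply/val_inj; exact: partial_cst. Qed.
Lemma partial_0 i : partial i 0 = 0 :> Cinf. Proof. exact: linear0. Qed.
Lemma partial_add i f g : partial i (f + g) = partial i f + partial i g.
Proof. exact: linearD. Qed.
Lemma partial_sub i f g : partial i (f - g) = partial i f - partial i g.
Proof. exact: linearB. Qed.
Lemma partial_muln i f n : partial i (f *+ n) = partial i f *+ n.
Proof. exact: linearMn. Qed.
Lemma partial_scale i c f : partial i (c *: f) = c *: partial i f.
Proof. exact: linearZ. Qed.
Let partialxy := (partial_xx, partial_xy, partial_yx, partial_yy).

(** At the origin the terms carrying a factor [x] or [y] drop out, so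
    the Laplacian of [x * p + y * q] there is twice the divergence of
    [(p, q)]. *)
Lemma lap_comb p q : lap (xx R * p + yy R * q) =
  (partial ix p + partial iy q) *+ 2 + (xx R * lap p + yy R * lap q).
Proof.
rewrite /lap !(partial_add, partial_mul, partialxy, partial_1, partial_0).
ring.
Qed.

Definition rsq : Cinf := xx R ^+ 2 + yy R ^+ 2.

Lemma partial_rsq_x : partial ix rsq = xx R *+ 2.
Proof. rewrite /rsq !expr2 partial_add !partial_mul !partialxy; ring. Qed.
Lemma partial_rsq_y : partial iy rsq = yy R *+ 2.
Proof. rewrite /rsq !expr2 partial_add !partial_mul !partialxy; ring. Qed.

Lemma Pi_E_top : (Pi_E R : mvfield R 2) finset.setT = rsq.
Proof. by rewrite [LHS]wedge2 v1x v1y v2x v2y /rsq; ring. Qed.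

(** Write [(a, b)] for the coefficients of [Q] and [D] for its
    divergence. The coefficient of the coboundary is [x * (x * D - 2 *
    a) + y * (y * D - 2 * b)], so it vanishes at the origin, and by
    [lap_comb] its Laplacian there is [2 * (2 * D - 2 * D) = 0]. *)
Lemma coboundary_jet (Q : mvfield R 2) : Q \in mvdeg 1 ->
  schouten (Pi_E R) Q finset.setT 0 = 0 /\ lap (schouten (Pi_E R) Q finset.setT) 0 = 0.
Proof.
move=> dQ.
have x0 : xx R 0 = 0 by rewrite /= mxE.
have y0 : yy R 0 = 0 by rewrite /= mxE.
pose a := Q [set ix]; pose b := Q [set iy].
pose D := partial ix a + partial iy b.
have -> : schouten (Pi_E R) Q finset.setT =
    xx R * (xx R * D - a *+ 2) + yy R * (yy R * D - b *+ 2).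
  rewrite schouten_bivector_vf //; last exact: bivector_deg.
  by rewrite Pi_E_top partial_rsq_x partial_rsq_y /rsq -/a -/b -/D; ring.
have at0 p q : (xx R * p + yy R * q) 0 = 0.
  by apply: (@etrans _ _ (xx R 0 * p 0 + yy R 0 * q 0)) => //; rewrite x0 y0 !mul0r addr0.
split; first exact: at0.
suff -> : lap (xx R * (xx R * D - a *+ 2) + yy R * (yy R * D - b *+ 2)) =
    xx R * (partial ix D *+ 2 + lap (xx R * D - a *+ 2)) +
    yy R * (partial iy D *+ 2 + lap (yy R * D - b *+ 2)) by exact: at0.
rewrite lap_comb !(partial_sub, partial_muln, partial_mul, partialxy).
move: (lap _) (lap _) (partial ix D) (partial iy D) => u v s t; rewrite /D.
move: (partial ix a) (partial iy b) => p q.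
ring.
Qed.

Definition bivec f : mvfield R 2 := [ffun S => if S == finset.setT then f else 0].

Lemma bivec_deg f : bivec f \in mvdeg 2.
Proof.
apply/mvdegP => S; rewrite ffunE; have [->|//] := eqVneq S finset.setT.
by rewrite cardsT card_ord.
Qed.

Lemma bivec_cocycle f : bivec f \in @cocycle R (poisson_complex (Pi_E R)) 2.
Proof.
rewrite inE; apply/andP; split; first exact: bivec_deg.
apply/eqP/ffunP => S; rewrite [RHS]ffunE.
apply: (mvdegP _ _ (schouten_bivector_deg (bivector_deg _) (bivec_deg f))).
by rewrite neq_ltn ltnS (leq_trans (max_card _)) ?card_ord.
Qed.

Definition pclass f : poisson_cohomology (Pi_E R) 2 :=
  qproj _ (Cocycle (bivec_cocycle f)).

(** Evaluation at the origin and the Laplacian at the origin are [1, 0]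
    on the constant 1, [0, 4] on [x^2 + y^2], and zero on coboundaries. *)
Lemma pclass_indep c d : c *: pclass 1 + d *: pclass rsq = 0 -> c = 0 /\ d = 0.
Proof.
move/eqP; rewrite qproj_comb0 inE /= => -[Q dQ].
move=> /(congr1 (fun P : mvfield R 2 => P finset.setT)).
have -> : (c *: bivec 1 + d *: bivec rsq : mvfield R 2) finset.setT = c *: 1 + d *: rsq.
  by rewrite !ffunE eqxx.
move=> E; have [] := coboundary_jet dQ.
rewrite -E => e0 l0.
have c0 : c = 0.
  rewrite -[RHS]e0.
  rewrite [RHS](_ : _ = c * 1 + d * ((0 : 'rV[R]_2) 0 ix ^+ 2 + (0 : 'rV[R]_2) 0 iy ^+ 2)) //.
  by rewrite !mxE; ring.
split=> //.
have lapE : lap (c *: 1 + d *: rsq) = d *: 4%:R.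
  have E1 i : partial i (c *: 1 + d *: rsq) = d *: partial i rsq.
    by rewrite partial_add 2!partial_scale partial_1 scaler0 add0r.
  rewrite /lap !E1 partial_rsq_x partial_rsq_y !(partial_scale, partial_muln, partialxy).
  by rewrite -scalerDr -mulrnDr.
move: l0; rewrite lapE => /eqP.
rewrite (_ : _ 0 = d * 4%:R) // mulf_eq0 pnatr_eq0 orbF => /eqP //.
Qed.

End PoissonSide.

(** * Comparison of the two cohomologies *)

Section ESide.
Variable R : realType.

Local Notation H := (Ecohomology (E_v1v2 R)).

(** Some nontrivial combination of two given two-forms has a value on
    the frame that vanishes at the origin, and such a form is exact. *)
Lemma Eclass_dep (a b : H 2) :
  exists c d : R, (c, d) <> (0, 0) /\ c *: a + d *: b = 0.
Proof.
have [w ->] := qprojP a; have [u ->] := qprojP b.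
pose top (z : cocycles (Ecomplex (E_v1v2 R)) 2) : R :=
  (cocycle_val z (pair2 (Ev1 R) (Ev2 R)) : smoothfun R 2) 0.
have exactP c d : c * top w + d * top u = 0 -> c *: qproj _ w + d *: qproj _ u = 0 :> H 2.
  move=> cd0; apply/eqP; rewrite qproj_comb0 inE /=.
  have /andP[Ez _] : cocycle_val (c *: w + d *: u) \in @cocycle R (Ecomplex (E_v1v2 R)) 2.
    by case: (c *: w + d *: u).
  by have [v Ev wE] := form2_exact Ez cd0; exists v.
have [w0|w0] := eqVneq (top w) 0.
  exists 1, 0; split; last by apply: exactP; rewrite w0 mulr0 mul0r addr0.
  by case=> /eqP; rewrite oner_eq0.
exists (top u), (- top w); split; last by apply: exactP; rewrite mulNr mulrC subrr.
by case=> _ /eqP; rewrite oppr_eq0 (negPf w0).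
Qed.

End ESide.

Theorem corollary36 (R : realType) :
  ~ graded_iso (Ecohomology (E_v1v2 R)) (poisson_cohomology (Pi_E R)).
Proof.
move=> [f /(_ 2%N)[g _ gK]].
have [c [d [cd0 cd]]] := Eclass_dep (g (pclass 1)) (g (pclass (rsq R))).
have := congr1 (f 2%N) cd; rewrite linear0 linearD !linearZ /= !gK.
by move=> /pclass_indep[c0 d0]; apply: cd0; rewrite c0 d0.
Qed.
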